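(* Let $m$ be a positive integer and let $G=B_m$ be the $m$-book graph, i.e. the graph on vertices $x_0,x_1,\ldots,x_m,y_0,y_1,\ldots,y_m$ with edges $\{x_0,x_i\}$, $\{y_0,y_i\}$ for $1\le i\le m$ and $\{x_i,y_i\}$ for $0\le i\le m$. Let $R=\mathbf{k}[x_0,\ldots,x_m,y_0,\ldots,y_m]$. Then $\operatorname{reg}(R/NI(G))=a_G=m+1$.
   Context: $\mathbf{k}$ is a field, vertices are identified with variables, $R$ is standard graded. ($B_m$ is the Cartesian product of the star graph with $m+1$ vertices and the path on two vertices.) The closed neighborhood ideal is $NI(G)=\langle \prod_{z\in N[w]}z : w\in V(G)\rangle$ with $N[w]=\{w\}\cup\{z:\{w,z\}\in E(G)\}$. $a_G$ is the matching number of $G$. *)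

(* Defs.v *)
From HB Require Import structures.
From mathcomp Require Import all_boot all_order all_algebra.
From mathcomp Require Import mpoly.
Set Implicit Arguments. Unset Strict Implicit. Unset Printing Implicit Defensive.
Import GRing.Theory.
Local Open Scope ring_scope.

(* The book graph B_m on 'I_(m.+1 + m.+1):
   lshift i  <-> x_i ,  rshift i <-> y_i   (i : 'I_m.+1).
   Edges: {x_0,x_i}, {y_0,y_i} (1 <= i <= m), {x_i,y_i} (0 <= i <= m). *)
Definition book_adj (m : nat) : rel 'I_(m.+1 + m.+1) :=
  fun u v =>
    match split u, split v with
    | inl i, inl j => ((val i == 0%N) && (val j != 0%N)) || ((val j == 0%N) && (val i != 0%N))
    | inr i, inr j => ((val i == 0%N) && (val j != 0%N)) || ((val j == 0%N) && (val i != 0%N))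
    | inl i, inr j => val i == val j
    | inr i, inl j => val i == val j
    end.

Definition closed_nbhd (n : nat) (adj : rel 'I_n) (w : 'I_n) : {set 'I_n} :=
  [set z | (z == w) || adj w z].

Definition is_matching (n : nat) (adj : rel 'I_n) (M : {set {set 'I_n}}) : bool :=
  [forall e in M, [exists u, [exists v, adj u v && (e == [set u; v])]]] &&
  [forall e in M, [forall f in M, (e != f) ==> [disjoint e & f]]].

Definition matching_number (n : nat) (adj : rel 'I_n) : nat :=
  \max_(M : {set {set 'I_n}} | is_matching adj M) #|M|.

Definition ideal_gen (k : fieldType) (n : nat) (V : finType) (g : V -> {mpoly k[n]})
  (f : {mpoly k[n]}) : Prop :=
  exists c : V -> {mpoly k[n]}, f = \sum_(v : V) c v * g v.

Definition NI_gen (k : fieldType) (n : nat) (adj : rel 'I_n) (w : 'I_n) : {mpoly k[n]} :=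
  \prod_(z in closed_nbhd adj w) 'X_z.

Definition NI (k : fieldType) (n : nat) (adj : rel 'I_n) : {mpoly k[n]} -> Prop :=
  ideal_gen (@NI_gen k n adj).

(* A finite graded free resolution of R/I:
     0 <- R/I <- F_0 <- F_1 <- F_2 <- ... <- F_p <- 0,
   F_i = ⊕_{j < b i} R(-a i j) (column vectors of length b i),
   the map F_{i+1} -> F_i is v |-> d i *m v.
   Graded: entry (k,j) of d i is homogeneous of degree a (i+1) j - a i k.
   Minimal: all entries of the differentials lie in the homogeneous maximal
   ideal (zero constant term). *)
Definition is_min_graded_free_res (k : fieldType) (n : nat) (I : {mpoly k[n]} -> Prop)
  (b : nat -> nat) (d : forall i, 'M[{mpoly k[n]}]_(b i, b i.+1))
  (a : forall i, 'I_(b i) -> nat) : Prop :=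
  [/\ b 0%N = 1%N,
      (forall j : 'I_(b 0%N), a 0%N j = 0%N),
      (exists p : nat, forall i, (p < i)%N -> b i = 0%N) &
   [/\
      (* the image of F_1 -> F_0 = R is I, so the cokernel is R/I *)
      (forall v : 'cV[{mpoly k[n]}]_(b 0%N),
          (exists w : 'cV_(b 1%N), v = d 0%N *m w) <-> (forall r, I (v r 0))),
      (forall i, d i *m d i.+1 = 0),
      (forall i (v : 'cV[{mpoly k[n]}]_(b i.+1)),
          d i *m v = 0 -> exists w : 'cV_(b i.+2), v = d i.+1 *m w),
      (forall i (r : 'I_(b i)) (j : 'I_(b i.+1)),
          d i r j \is (a i.+1 j - a i r)%N.-homog) &
      (forall i (r : 'I_(b i)) (j : 'I_(b i.+1)), (d i r j)@_0%MM = 0)]].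

Definition regularity_is (k : fieldType) (n : nat) (I : {mpoly k[n]} -> Prop) (r : nat) : Prop :=
  (exists b d a, @is_min_graded_free_res k n I b d a) /\
  (forall b d a, @is_min_graded_free_res k n I b d a ->
     (forall i (j : 'I_(b i)), (a i j <= i + r)%N) /\
     (exists i (j : 'I_(b i)), a i j = (i + r)%N)).

(* Main.v *)
(* Write u = x_0, v = y_0, e_i = x_i y_i. Then NI(B_m) is generated by u e_i, v e_i
   (1 <= i <= m), u v x_1 ... x_m and u v y_1 ... y_m. Adding the generators in the order
   u e_1, v e_1, u e_2, v e_2, ..., u v x_1 ... x_m, u v y_1 ... y_m, the successive colon
   ideals are (e_1, ..., e_(i-1)), (e_1, ..., e_(i-1), u), (y_1, ..., y_m) and
   (x_1, ..., x_m). All of these are resolved by Koszul complexes, which are themselves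
   iterated mapping cones. At each step the generators of the i-th module of the shifted
   resolution of the colon ideal have larger degree than those of the i-th module of the
   resolution already built. A graded lift of the multiplication map therefore has no
   constant entries, whatever the lift, and the mapping cone is again minimal. This gives
   a minimal resolution whose degrees are at most i + m + 1 in homological degree i, with
   equality at the generator u v y_1 ... y_m. Any other minimal resolution has the same
   degrees. *)
Require Import Defs.
From HB Require Import structures.
From Stdlib Require Import IndefiniteDescription.
From mathcomp Require Import all_boot all_order all_algebra.
From mathcomp Require Import mpoly zify.
Set Implicit Arguments. Unset Strict Implicit. Unset Printing Implicit Defensive.
Import GRing.Theory.
Local Open Scope ring_scope.

(** * Polynomials with prescribed exponents, and homogeneous components *)

Section Support.
Variables (k : fieldType) (n : nat).
Implicit Types (p q : {mpoly k[n]}) (P Q : pred 'X_{1..n}) (m : 'X_{1..n}).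

(** Serves two purposes: with a degree condition as [P] it expresses homogeneity, with an upward
    closed [P] it expresses membership in a monomial ideal. *)
Definition supported P p := all P (msupp p).

Lemma supportedP P p : reflect {in msupp p, forall m, P m} (supported P p).
Proof. exact: allP. Qed.

Lemma sub_supported P Q p :
  (forall m, P m -> Q m) -> supported P p -> supported Q p.
Proof. by move=> PQ; apply: sub_all. Qed.

Lemma supported0 P : supported P 0.
Proof. by rewrite /supported -mpolyC0 msupp0. Qed.

Lemma supportedX P m : P m -> supported P 'X_[m].
Proof. by rewrite /supported msuppX /= => ->. Qed.

Lemma supportedD P p q : supported P p -> supported P q -> supported P (p + q).
Proof.
move=> /supportedP hp /supportedP hq; apply/supportedP => m /msuppD_le.
by rewrite mem_cat => /orP[/hp|/hq].
Qed.

Lemma supported_sum (I : Type) (r : seq I) (B : pred I) P (F : I -> {mpoly k[n]}) :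
  (forall i, B i -> supported P (F i)) -> supported P (\sum_(i <- r | B i) F i).
Proof.
move=> hF; apply: (big_ind (fun p => supported P p)) => //.
- exact: supported0.
- by move=> p q; apply: supportedD.
Qed.

Lemma supportedM P Q (S : pred _) p q : (forall m m', P m -> Q m' -> S (m + m')%MM) ->
  supported P p -> supported Q q -> supported S (p * q).
Proof.
move=> PQS /supportedP hp /supportedP hq; apply/supportedP => m /msuppM_le.
by case/allpairsP => -[m1 m2] /= [/hp h1 /hq h2 ->]; apply: PQS.
Qed.

Lemma supportedMX P m p :
  supported P (p * 'X_[m]) = supported (fun m' => P (m' + m)%MM) p.
Proof.
rewrite /supported (perm_all _ (msuppMX p m)) all_map.
by apply: eq_all => m' /=; rewrite addmC.
Qed.

Definition mpart P p := \sum_(m <- msupp p | P m) p@_m *: 'X_[m].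

Lemma mcoeff_mpart P p m : (mpart P p)@_m = if P m then p@_m else 0.
Proof.
rewrite /mpart raddf_sum /=.
have [mp|mNp] := boolP (m \in msupp p); last first.
  rewrite (memN_msupp_eq0 mNp) if_same big_seq_cond big1 // => m' /andP[m'p _].
  rewrite mcoeffZ mcoeffX; case: eqP => [e|_]; last by rewrite mulr0.
  by rewrite -e m'p in mNp.
rewrite big_mkcond (bigD1_seq m) ?msupp_uniq //= big1 => [|m' ne].
  by case: (P m); rewrite addr0 // mcoeffZ mcoeffX eqxx mulr1.
by case: (P m') => //; rewrite mcoeffZ mcoeffX (negPf ne) mulr0.
Qed.

Lemma mpartD P p q : mpart P (p + q) = mpart P p + mpart P q.
Proof.
by apply/mpolyP => m; rewrite mcoeffD !mcoeff_mpart; case: (P m); rewrite ?mcoeffD ?addr0.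
Qed.

Lemma mpart0 P : mpart P 0 = 0.
Proof. by apply/mpolyP => m; rewrite mcoeff_mpart !mcoeff0 if_same. Qed.

Lemma supported_mpart P p : supported P (mpart P p).
Proof.
apply/supportedP => m; rewrite mcoeff_msupp mcoeff_mpart.
by case: (P m) => //; rewrite eqxx.
Qed.

Lemma mpart_id P p : supported P p -> mpart P p = p.
Proof.
move=> /supportedP hp; apply/mpolyP => m; rewrite mcoeff_mpart.
case: ifP => // /negP nP; apply/esym/memN_msupp_eq0.
by apply/negP => /hp.
Qed.

Lemma mpart_eq0 P p : supported (fun m => ~~ P m) p -> mpart P p = 0.
Proof.
move=> /supportedP hp; apply/mpolyP => m; rewrite mcoeff_mpart mcoeff0.
case: ifP => // Pm; apply: memN_msupp_eq0.
by apply/negP => /hp /=; rewrite Pm.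
Qed.

Lemma mpart_split P p : p = mpart P p + mpart (fun m => ~~ P m) p.
Proof.
apply/mpolyP => m; rewrite mcoeffD !mcoeff_mpart /=.
by case: (P m); rewrite ?addr0 ?add0r.
Qed.

(* [x] and [y] are the degrees of a row and of a column: an entry of that type
   has degree [y - x] in Z, hence vanishes when [y < x]. *)
Definition deg_shift (x y : nat) : pred 'X_{1..n} := fun m => (mdeg m + x == y)%N.

Lemma deg_shiftM x y z p q : supported (deg_shift x y) p ->
  supported (deg_shift y z) q -> supported (deg_shift x z) (p * q).
Proof.
by apply: supportedM => m m' /eqP <- /eqP <-; rewrite /deg_shift mdegD addnCA addnA.
Qed.

(** Multiplication by a form sends distinct degrees to distinct degrees, so it commutes with taking
    a homogeneous component. *)
Lemma mpart_degM x y z p q : supported (deg_shift x y) p ->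
  mpart (deg_shift x z) (p * q) = p * mpart (deg_shift y z) q.
Proof.
move=> hp; rewrite {1}[q](mpart_split (deg_shift y z)) mulrDr mpartD.
rewrite mpart_id; last exact: deg_shiftM (supported_mpart _ _).
rewrite [X in _ + X]mpart_eq0 ?addr0 //.
apply: (supportedM _ hp (supported_mpart _ _)) => m m' /eqP <- /= ne.
move: ne; rewrite /deg_shift mdegD; lia.
Qed.

Lemma deg_shift_homog x y p :
  supported (deg_shift x y) p -> p \is (y - x)%N.-homog.
Proof.
move=> /supportedP hp; apply/dhomogP => m /hp /eqP <-.
by rewrite addnK.
Qed.

Lemma deg_shift_coeff0 x y p :
  (x < y)%N -> supported (deg_shift x y) p -> p@_0 = 0.
Proof.
move=> xy /supportedP hp; apply: memN_msupp_eq0; apply/negP => /hp.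
by rewrite /deg_shift mdeg0; lia.
Qed.

(** Truncated subtraction hides the case [y <= x]: there [p] is constant, and its vanishing constant
    term makes it zero. *)
Lemma homog_deg_shift x y p : p \is (y - x)%N.-homog -> p@_0 = 0 ->
  supported (deg_shift x y) p.
Proof.
move=> /dhomogP hp p0; apply/supportedP => m mp; rewrite /deg_shift (hp m mp).
have : mdeg m != 0%N.
  rewrite mdeg_eq0; apply: contraTneq mp => ->.
  by rewrite mcoeff_msupp p0 eqxx.
by rewrite (hp m mp); lia.
Qed.

End Support.

(** * Homogeneous solutions of linear systems *)

Section Lift.
Variables (k : fieldType) (n : nat).
Local Notation R := {mpoly k[n]}.

Lemma mulmx_cols r s t (A : 'M[R]_(r, s)) (C : 'M[R]_(r, t)) :
  (forall j, exists w, col j C = A *m w) -> exists X, C = A *m X.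
Proof.
move=> /fin_all_exists[w hw]; exists (\matrix_(i, j) w j i 0).
apply/matrixP => i j; move/colP: (hw j) => /(_ i); rewrite !mxE => ->.
by apply: eq_bigr => l _; rewrite mxE.
Qed.

Definition graded r s (x : 'I_r -> nat) (y : 'I_s -> nat) (A : 'M[R]_(r, s)) :=
  forall i j, supported (deg_shift (x i) (y j)) (A i j).

Lemma graded_mulmx r s t x y z (A : 'M[R]_(r, s)) (B : 'M[R]_(s, t)) :
  graded x y A -> graded y z B -> graded x z (A *m B).
Proof.
move=> hA hB i j; rewrite mxE; apply: supported_sum => l _.
exact: deg_shiftM (hA _ _) (hB _ _).
Qed.

(** The homogeneous components, in the right degrees, of the entries of any solution again form a
    solution. *)
Lemma graded_solution r s t x y z (A : 'M[R]_(r, s)) (C : 'M[R]_(r, t)) :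
  graded x y A -> graded x z C -> (exists X, C = A *m X) ->
  exists2 X, C = A *m X & graded y z X.
Proof.
move=> hA hC [X CX].
exists (\matrix_(i, j) mpart (deg_shift (y i) (z j)) (X i j)); last first.
  by move=> i j; rewrite mxE; apply: supported_mpart.
apply/matrixP => i j; rewrite -(mpart_id (hC i j)) CX !mxE.
have -> : mpart (deg_shift (x i) (z j)) (\sum_l A i l * X l j) =
          \sum_l mpart (deg_shift (x i) (z j)) (A i l * X l j).
  by apply: (big_morph _ (@mpartD _ _ _) (@mpart0 _ _ _)).
by apply: eq_bigr => l _; rewrite mxE (mpart_degM _ _ (hA i l)).
Qed.

End Lift.

(** * Comparison of minimal resolutions *)

(** In a resolution [b 0] equals 1 only up to a proof; this lemma and the next handle the indices of
    F_0. *)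
Lemma ord_eq1 (N : nat) (e : N = 1%N) (r s : 'I_N) : r = s.
Proof. by subst N; rewrite !ord1. Qed.

Lemma sum_ord_eq1 (V : nmodType) (N : nat) (e : N = 1%N) (s : 'I_N) (F : 'I_N -> V) :
  \sum_i F i = F s.
Proof. by subst N; rewrite big_ord1 (ord1 s). Qed.

Section Resolutions.
Variables (k : fieldType) (n : nat).
Local Notation R := {mpoly k[n]}.
Implicit Types (I : R -> Prop) (f : 'X_{1..n}).

Lemma min_res_graded I b d a : @is_min_graded_free_res k n I b d a ->
  forall i, graded (a i) (a i.+1) (d i).
Proof. by case=> _ _ _ [_ _ _ hd h0] i r j; apply: homog_deg_shift. Qed.

Lemma const_mulmx N M (e : N = 1%N) (x : R) r (A : 'M[R]_(N, M)) s :
  (const_mx x : 'M_(r, N)) *m A = \matrix_(i, j) (A s j * x).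
Proof.
apply/matrixP => i' j'; rewrite !mxE (sum_ord_eq1 e s) mxE mulrC //.
Qed.

(** Comparison theorem: multiplication by the monomial maps R/I' to R/I and lifts along the exact
    complex over [I], each lift being chosen homogeneous. *)
Lemma chain_map I I' b d a b' d' a' f :
  @is_min_graded_free_res k n I b d a -> @is_min_graded_free_res k n I' b' d' a' ->
  (forall p, I' p -> I (p * 'X_[f])) ->
  exists phi : forall i, 'M[R]_(b i, b' i),
    [/\ phi 0%N = const_mx 'X_[f],
        forall i, phi i *m d' i = d i *m phi i.+1 &
        forall i, graded (a i) (fun j => a' i j + mdeg f)%N (phi i)].
Proof.
move=> hF hG hI.
have gF := min_res_graded hF; have gG := min_res_graded hG.
case: hF => b0 a0 _ [im0 dd ex _ _]; case: hG => b'0 a'0 _ [im'0 dd' _ _ _].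
(* Factorization through [d i] is what permits one further lift, so it is carried along with the
   grading. *)
pose E i (phi : 'M[R]_(b i, b' i)) := (exists X, phi *m d' i = d i *m X) /\
  graded (a i) (fun j => a' i j + mdeg f)%N phi.
have step i phi : E i phi -> {phi' | E i.+1 phi' & phi *m d' i = d i *m phi'}.
  move=> Ephi.
  (* Existence is turned into data so that the lifts can be defined by recursion. *)
  suff /constructive_indefinite_description[phi' []] :
      exists phi', E i.+1 phi' /\ phi *m d' i = d i *m phi' by exists phi'.
  case: Ephi => hX gphi.
  have gphid : graded (a i) (fun j => a' i.+1 j + mdeg f)%N (phi *m d' i).
    apply: graded_mulmx gphi _ => r j; apply: sub_supported (gG i r j) => m.
    by rewrite /deg_shift; lia.
  have [X eX gX] := graded_solution (gF i) gphid hX.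
  exists X; split=> //; split=> //.
  apply: mulmx_cols => j; apply: ex.
  by rewrite colE !mulmxA -eX -(mulmxA phi) dd' mulmx0 mul0mx.
have E0 : E 0%N (const_mx 'X_[f]).
  split=> [|r j]; last first.
    by rewrite mxE a0 a'0; apply: supportedX; rewrite /deg_shift addn0 add0n.
  apply: mulmx_cols => j; apply/im0 => r.
  have s0 : 'I_(b' 0%N) by rewrite b'0; exact: ord0.
  rewrite mxE (const_mulmx b'0 _ _ _ s0) mxE; apply: hI.
  have : exists w, col j (d' 0%N) = d' 0%N *m w by exists (delta_mx j 0); rewrite colE.
  by move/im'0 => /(_ s0); rewrite mxE.
pose fix Phi i : {phi | E i phi} :=
  if i is i'.+1 then let: exist2 phi' h _ := step i' _ (svalP (Phi i')) in exist _ phi' h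
  else exist _ _ E0.
exists (fun i => sval (Phi i)); split=> [//|i|i].
- by rewrite /=; case: (step _ _ _).
- by case: (Phi i) => phi [].
Qed.

(* Over two resolutions of the same ideal the lifts of the identity compose to
   a map homotopic to the identity, hence equal to it modulo the maximal ideal. *)
Lemma min_res_degrees I b d a b' d' a' :
  @is_min_graded_free_res k n I b d a -> @is_min_graded_free_res k n I b' d' a' ->
  forall i (j : 'I_(b i)), exists j' : 'I_(b' i), a' i j' = a i j.
Proof.
move=> hF hG.
have hI p : I p -> I (p * 'X_[0]) by rewrite mpolyX0 mulr1.
have [phi [phi0 phid gphi]] := chain_map hG hF hI.
have [psi [psi0 psid _]] := chain_map hF hG hI.
case: hF => b0 a0 _ [im0 dd ex _ dmin]; case: hG => b'0 a'0 _ [_ _ _ _ _].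
(* In homological degree 0 both modules are R, generated in degree 0. *)
move=> [j|i j]; first by exists (cast_ord (esym (etrans b'0 (esym b0))) j); rewrite a0 a'0.
pose theta i := psi i *m phi i - 1%:M.
have thetad l : d l *m theta l.+1 = theta l *m d l.
  by rewrite mulmxBr mulmxBl mulmxA -psid -mulmxA -phid mulmxA mulmx1 mul1mx.
have theta0 : theta 0%N = 0.
  apply/matrixP => r s; rewrite !mxE.
  have t0 : 'I_(b' 0%N) by rewrite b'0; exact: ord0.
  rewrite (sum_ord_eq1 b'0 t0) psi0 phi0 !mxE mpolyX0 mulr1.
  by rewrite (ord_eq1 b0 r s) eqxx subrr.
(* Null homotopy of [theta], one degree at a time: [h] corrects [theta l.+1] into the kernel of
   [d l], and exactness gives the next map. *)
have htp l : exists h, d l *m (theta l.+1 - h *m d l) = 0.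
  elim: l => [|l [h eh]].
    by exists 0; rewrite mul0mx subr0 thetad theta0 mul0mx.
  have [h' eh'] : exists h', theta l.+1 - h *m d l = d l.+1 *m h'.
    apply: mulmx_cols => c; apply: ex.
    by rewrite colE mulmxA eh mul0mx.
  exists h'; rewrite mulmxBr mulmxA -eh' mulmxBl -(mulmxA h) dd mulmx0 subr0.
  by rewrite thetad subrr.
have [h eh] := htp i.
have [h' eh'] : exists h', theta i.+1 - h *m d i = d i.+1 *m h'.
  by apply: mulmx_cols => c; apply: ex; rewrite colE mulmxA eh mul0mx.
have thetaE : theta i.+1 = d i.+1 *m h' + h *m d i by rewrite -eh' subrK.
have c0M (p q : R) : (p * q)@_0 = p@_0 * q@_0 := rmorphM (mcoeff 0%MM) p q.
(* Both terms of the homotopy contain a differential, whose entries have no constant term. *)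
have : (theta i.+1 j j)@_0 = 0.
  rewrite thetaE !mxE mcoeffD !raddf_sum /= !big1 ?addr0 // => l _.
    by rewrite c0M dmin mulr0.
  by rewrite c0M dmin mul0r.
rewrite !mxE eqxx mcoeffB raddf_sum /= mcoeff1 eqxx => /eqP; rewrite subr_eq0 => /eqP e1.
(* The diagonal entry of [psi *m phi] has constant term 1, so column [j] of [phi] has an entry with
   a nonzero one; by homogeneity its row and column degrees agree. *)
have [j' j'P] : exists j', (phi i.+1 j' j)@_0 != 0.
  apply/existsP; apply: contraT; rewrite negb_exists => /forallP z.
  move/eqP: e1; rewrite big1 ?(eq_sym _ 1) ?oner_eq0 // => l _.
  by rewrite c0M; move: (z l); rewrite negbK => /eqP ->; rewrite mulr0.
exists j'; rewrite -mcoeff_msupp in j'P.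
have /supportedP/(_ _ j'P)/eqP := gphi i.+1 j' j.
by rewrite !mdeg0 add0n addn0.
Qed.

End Resolutions.

(** * Mapping cones of graded resolutions *)

Section Cone.
Variables (k : fieldType) (n : nat).
Local Notation R := {mpoly k[n]}.
Implicit Types (P : pred 'X_{1..n}) (f : 'X_{1..n}).

Definition mon_ideal P : R -> Prop := fun p => supported P p.

(** Cone of a map from G(-delta) to F: F_0 in degree 0, then the sum of F_i and G_(i-1)(-delta). *)
Definition cone_b (b b' : nat -> nat) i :=
  match i with 0 => b 0%N | l.+1 => (b l.+1 + b' l)%N end.

Definition cone_d b b' (d : forall i, 'M[R]_(b i, b i.+1))
    (d' : forall i, 'M[R]_(b' i, b' i.+1)) (phi : forall i, 'M[R]_(b i, b' i)) i :
    'M[R]_(cone_b b b' i, cone_b b b' i.+1) :=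
  match i with
  | 0 => row_mx (d 0%N) (phi 0%N)
  | l.+1 => block_mx (d l.+1) (phi l.+1) 0 (- d' l)
  end.

Definition cone_a b b' (a : forall i, 'I_(b i) -> nat) (a' : forall i, 'I_(b' i) -> nat)
    (delta : nat) i : 'I_(cone_b b b' i) -> nat :=
  match i with
  | 0 => a 0%N
  | l.+1 => fun j => match split j with inl r => a l.+1 r | inr r => (a' l r + delta)%N end
  end.

(** [Q i x] allows generators of degree [x] in homological degree [i]; it may be a mere bound. *)
Definition has_min_res P (Q : nat -> nat -> Prop) := exists b d a,
  @is_min_graded_free_res k n (mon_ideal P) b d a /\ forall i (j : 'I_(b i)), Q i (a i j).

Lemma supportedUX P f (p : R) : supported (fun m => P m || (f <= m)%MM) p ->
  exists q r, supported P q /\ p = q + r * 'X_[f].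
Proof.
move=> /supportedP hp; exists (mpart P p).
exists (\sum_(m <- msupp p | ~~ P m) p@_m *: 'X_[(m - f)%MM]); split.
  exact: supported_mpart.
rewrite {1}[p](mpart_split P); congr (_ + _).
rewrite mulr_suml /mpart big_seq_cond [RHS]big_seq_cond.
apply: eq_bigr => m /andP[mp nP].
by rewrite -scalerAl -mpolyXD submK //; move: (hp m mp); rewrite (negPf nP).
Qed.

(** The cone belongs to 0 -> R/(I : X^f)(-deg f) -> R/I -> R/(I + (X^f)) -> 0, where [P'] describes
    the colon ideal. The strict degree inequality excludes constant entries in any graded lift,
    hence minimality. *)
Lemma cone_min_res P P' f (Q Q' Q'' : nat -> nat -> Prop) :
  has_min_res P Q -> has_min_res P' Q' ->
  (forall m, P' m = P (m + f)%MM) ->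
  (forall i x y, Q i x -> Q' i y -> x < y + mdeg f)%N ->
  (forall i x, Q i x -> Q'' i x) ->
  (forall i x, Q' i x -> Q'' i.+1 (x + mdeg f)%N) ->
  exists b d a,
    [/\ is_min_graded_free_res (mon_ideal (fun m => P m || (f <= m)%MM)) d a,
        forall i (j : 'I_(b i)), Q'' i (a i j) &
        exists j : 'I_(b 1%N), a 1%N j = mdeg f].
Proof.
move=> [b [d [a [hF hQ]]]] [b' [d' [a' [hG hQ']]]] PP' lt QQ'' Q'Q''.
have hI p : mon_ideal P' p <-> mon_ideal P (p * 'X_[f]).
  by rewrite /mon_ideal supportedMX /supported (eq_all PP').
have [phi [phi0 phid gphi]] := chain_map hF hG (fun p => proj1 (hI p)).
case: hF => b0 a0 [p fin] [im0 dd ex hom dmin].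
case: hG => b'0 a'0 [p' fin'] [im'0 dd' ex' hom' dmin'].
have [s0 _] : exists s0 : 'I_(b' 0%N), True.
  by rewrite b'0; exists ord0.
have phi0E (v : 'cV_(b' 0%N)) : phi 0%N *m v = \col_i (v s0 0 * 'X_[f]).
  by rewrite phi0 (const_mulmx b'0 _ _ _ s0); apply/matrixP => r c; rewrite !mxE ord1.
(* Once the lower part is a boundary [d' i *m w], the sum of [v1] and [phi i.+1 *m w] is a cycle of
   F, hence a boundary. This serves in every homological degree. *)
have tail i (v1 : 'cV_(b i.+1)) (v2 : 'cV_(b' i)) (w : 'cV_(b' i.+1)) :
    v2 = d' i *m w -> d i *m v1 + phi i *m v2 = 0 ->
    exists w', col_mx v1 v2 = cone_d d d' phi i.+1 *m w'.
  move=> -> /=; rewrite mulmxA phid -mulmxA -mulmxDr => /ex[w1 ew1].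
  exists (col_mx w1 (- w)); rewrite mul_block_col !mulmxN -ew1 addrK mul0mx add0r.
  by rewrite mulNmx opprK.
exists (cone_b b b'), (cone_d d d' phi), (cone_a a a' (mdeg f)); split; first last.
- exists (rshift (b 1%N) s0); rewrite /= (unsplitK (inr s0)).
  by rewrite a'0.
- case=> [|i] j /=; first exact/QQ''/hQ.
  by case: (split j) => r; [apply/QQ''/hQ|apply/Q'Q''/hQ'].
split=> //.
  (* The copy of G is shifted by one, hence the extra unit. *)
  exists (maxn p p').+1 => -[//|i] hi /=.
  by rewrite fin ?fin' //; lia.
split.
- move=> v; split=> [[w ->] r|hv].
    rewrite -[w]vsubmxK mul_row_col mxE; apply: supportedD.
      apply: (@sub_supported _ _ P) => [m ->//|].
      by move: r; apply/im0; exists (usubmx w).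
    rewrite phi0E mxE supportedMX; apply/supportedP => m _.
    by rewrite lem_addl orbT.
  have r0 : 'I_(b 0%N) by rewrite b0; exact: ord0.
  have [q [r [hq e]]] := supportedUX (hv r0).
  have [w1 ew1] : exists w, (const_mx q : 'cV_(b 0%N)) = d 0%N *m w.
    by apply/im0 => s; rewrite mxE.
  exists (col_mx w1 (const_mx r)); rewrite mul_row_col -ew1 phi0E.
  by apply/matrixP => s t; rewrite !mxE (ord_eq1 b0 s r0) ord1.
- case=> [|i] /=.
    by rewrite mul_row_block dd mulmx0 addr0 mulmxN -phid subrr row_mx0.
  rewrite mulmx_block !dd !mul0mx !mulmx0 !addr0 !mulmxN -phid subrr.
  by rewrite mulNmx opprK dd' addr0 block_mx0.
- case=> [|i] /= v; rewrite -[v]vsubmxK.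
    rewrite mul_row_col => e.
    (* The relation puts X^f times the lower entry in [I], so this entry lies in the colon ideal,
       the image of [d' 0]. *)
    have [w ew] : exists w, dsubmx v = d' 0%N *m w.
      apply/im'0 => r; apply/hI.
      have : exists w, phi 0%N *m dsubmx v = d 0%N *m w.
        by exists (- usubmx v); rewrite mulmxN; apply/eqP; rewrite -addr_eq0 addrC e.
      have r0 : 'I_(b 0%N) by rewrite b0; exact: ord0.
      move/im0 => /(_ r0); rewrite phi0E mxE.
      by rewrite (ord_eq1 b'0 r s0).
    exact: tail ew e.
  rewrite mul_block_col mul0mx add0r mulNmx -col_mx0 => /eq_col_mx[e1 /eqP].
  by rewrite oppr_eq0 => /eqP/ex'[w ew]; apply: tail ew e1.
- case=> [|i] r j /=; case: (split_ordP j) => c ->; rewrite ?(unsplitK (inl c)) ?(unsplitK (inr c)).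
  + by rewrite row_mxEl.
  + by rewrite row_mxEr; apply/deg_shift_homog/gphi.
  + case: (split_ordP r) => s ->; rewrite ?(unsplitK (inl s)) ?(unsplitK (inr s)).
      by rewrite block_mxEul.
    by rewrite block_mxEdl mxE dhomog0.
  + case: (split_ordP r) => s ->; rewrite ?(unsplitK (inl s)) ?(unsplitK (inr s)).
      by rewrite block_mxEur; apply/deg_shift_homog/gphi.
    by rewrite block_mxEdr mxE dhomogN subnDr.
- have phi_min i r j : (phi i r j)@_0 = 0.
    by apply: deg_shift_coeff0 (gphi i r j); apply: lt (hQ _ _) (hQ' _ _).
  case=> [|i] r j /=; case: (split_ordP j) => c ->.
  + by rewrite row_mxEl.
  + by rewrite row_mxEr.
  + by case: (split_ordP r) => s ->; rewrite ?block_mxEul // block_mxEdl mxE mcoeff0.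
  + by case: (split_ordP r) => s ->; rewrite ?block_mxEur // block_mxEdr mxE mcoeffN dmin' oppr0.
Qed.

Lemma cone_has_min_res P P' f (Q Q' Q'' : nat -> nat -> Prop) :
  has_min_res P Q -> has_min_res P' Q' ->
  (forall m, P' m = P (m + f)%MM) ->
  (forall i x y, Q i x -> Q' i y -> x < y + mdeg f)%N ->
  (forall i x, Q i x -> Q'' i x) ->
  (forall i x, Q' i x -> Q'' i.+1 (x + mdeg f)%N) ->
  has_min_res (fun m => P m || (f <= m)%MM) Q''.
Proof.
move=> hP hP' e lt h h'.
by have [b [d [a [res hQ _]]]] := cone_min_res hP hP' e lt h h'; exists b, d, a.
Qed.

Lemma min_res_ext (I I' : R -> Prop) b d a : (forall p, I p <-> I' p) ->
  @is_min_graded_free_res k n I b d a -> @is_min_graded_free_res k n I' b d a.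
Proof.
move=> e [b0 a0 fin [im0 dd ex hom dmin]]; split=> //; split=> // v.
by split=> [/im0 h r|h]; [apply/e|apply/im0 => r; apply/e].
Qed.

Lemma eq_has_min_res P P' (Q Q' : nat -> nat -> Prop) :
  P =1 P' -> (forall i x, Q i x -> Q' i x) -> has_min_res P Q -> has_min_res P' Q'.
Proof.
move=> e QQ' [b [d [a [res hQ]]]]; exists b, d, a; split=> [|i j]; last exact/QQ'/hQ.
by apply: min_res_ext res => p; rewrite /mon_ideal /supported (eq_all e).
Qed.

(** Base of the inductions: for the zero ideal, R alone is the resolution. *)
Lemma has_min_res0 (Q : nat -> nat -> Prop) : Q 0%N 0%N -> has_min_res (fun=> false) Q.
Proof.
move=> Q0; exists (fun i => (i == 0%N) : nat), (fun i => 0), (fun i j => 0%N).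
split; last by case=> [|i] [].
split=> //; first by exists 0%N; case.
split=> // [v|i|i v _|i r j|i r j].
- split=> [[w ->] r|hv]; first by rewrite mul0mx mxE; apply: supported0.
  exists 0; rewrite mulmx0; apply/matrixP => r c; rewrite mxE (ord1 c).
  apply/mpolyP => m; rewrite mcoeff0; apply: memN_msupp_eq0.
  by apply/negP => mp; have /supportedP/(_ _ mp) := hv r.
- by rewrite mulmx0.
- by exists 0; apply/matrixP => -[].
- by rewrite mxE dhomog0.
- by rewrite mxE mcoeff0.
Qed.

End Cone.

(** * Squarefree monomial ideals *)

Section Squarefree.
Variables (k : fieldType) (n : nat).
Implicit Types (A B S : {set 'I_n}) (p : pred {set 'I_n}) (s : seq {set 'I_n}).

Definition set_mnm A : 'X_{1..n} := [multinom (z \in A : nat) | z < n].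
Definition mnm_supp (m : 'X_{1..n}) : {set 'I_n} := [set z | 0 < m z]%N.

Lemma set_mnm_le A m : (set_mnm A <= m)%MM = (A \subset mnm_supp m).
Proof.
apply/mnm_lepP/subsetP => h z => [zA|]; first by have := h z; rewrite mnmE zA inE.
by rewrite mnmE; case: (boolP (z \in A)) => // /h; rewrite inE.
Qed.

Lemma mnm_suppD m A : mnm_supp (m + set_mnm A)%MM = mnm_supp m :|: A.
Proof. by apply/setP => z; rewrite !inE mnmDE mnmE addn_gt0; case: (z \in A). Qed.

Lemma mdeg_set_mnm A : mdeg (set_mnm A) = #|A|.
Proof.
rewrite mdegE -sum1_card [RHS]big_mkcond /=; apply: eq_bigr => z _.
by rewrite mnmE; case: (z \in A).
Qed.

Lemma mpolyX_set_mnm A : 'X_[set_mnm A] = \prod_(z in A) 'X_z :> {mpoly k[n]}.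
Proof.
rewrite mpolyXE_id [RHS]big_mkcond; apply: eq_bigr => z _.
by rewrite mnmE; case: (z \in A).
Qed.

(* Membership of a monomial in a squarefree monomial ideal only depends on its
   support, so such ideals are encoded as predicates on sets of variables. *)
Definition sqfree_res p := has_min_res k (fun m => p (mnm_supp m)).

(** Multiplying by the squarefree monomial of [B] unites the support with [B], so colon ideals are
    read off on sets. *)
Lemma sqfree_cone p p' B (Q Q' Q'' : nat -> nat -> Prop) :
  sqfree_res p Q -> sqfree_res p' Q' ->
  (forall S, p' S = p (S :|: B)) ->
  (forall i x y, Q i x -> Q' i y -> x < y + #|B|)%N ->
  (forall i x, Q i x -> Q'' i x) ->
  (forall i x, Q' i x -> Q'' i.+1 (x + #|B|)%N) ->
  sqfree_res (fun S => p S || (B \subset S)) Q''.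
Proof.
rewrite -mdeg_set_mnm => hp hp' e lt h h'.
have e' m : p' (mnm_supp m) = p (mnm_supp (m + set_mnm B)%MM) by rewrite e mnm_suppD.
apply: eq_has_min_res (cone_has_min_res hp hp' e' lt h h') => // m.
by rewrite set_mnm_le.
Qed.

(** Encodes the ideal generated by the squarefree monomials of the sets in [s]. *)
Definition contains_some s : pred {set 'I_n} := fun S => has (fun A => A \subset S) s.

Lemma subsetU_disjoint A B S : [disjoint A & B] -> (A \subset S :|: B) = (A \subset S).
Proof. by move=> dAB; rewrite setUC -subDset (setDidPl dAB). Qed.

Lemma contains_someU_disjoint s S B : all (fun A => [disjoint A & B]) s ->
  contains_some s (S :|: B) = contains_some s S.
Proof.
by move=> /allP dsB; apply: eq_in_has => A /dsB; apply: subsetU_disjoint.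
Qed.

(* For pairwise disjoint sets this is the Koszul complex of a regular sequence
   of monomials of degree [c]. *)
Lemma koszul_res s c : (0 < c)%N -> all (fun A => #|A| == c) s ->
  pairwise (fun A B => [disjoint A & B]) s ->
  sqfree_res (contains_some s) (fun i x => (i <= size s)%N /\ x = (c * i)%N).
Proof.
move=> c0; elim: s => [|B s IH] /=; first by move=> _ _; apply: has_min_res0; rewrite muln0.
case/andP => /eqP cB cs /andP[dB ds].
have {}IH := IH cs ds.
(* [B] is disjoint from the sets of [s], so the colon ideal is the ideal itself and the Koszul
   complex is coned with itself. *)
have e S : contains_some s S = contains_some s (S :|: B).
  rewrite contains_someU_disjoint //.
  by apply: sub_all dB => A; rewrite disjoint_sym.
apply: eq_has_min_res (sqfree_cone
  (Q'' := fun i x => i <= (size s).+1 /\ x = c * i)%N IH IH e _ _ _) => //.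
- by move=> m; rewrite /= orbC.
- by move=> i x y [_ ->] [_ ->]; rewrite cB; lia.
- by move=> i x [? ->]; split=> //; lia.
- by move=> i x [? ->]; rewrite cB mulnS addnC.
Qed.

(** The generators are monomials, so membership can be tested one monomial at a time. *)
Lemma NI_mon_ideal (adj : rel 'I_n) (f : {mpoly k[n]}) :
  NI adj f <-> mon_ideal (fun m => [exists w, closed_nbhd adj w \subset mnm_supp m]) f.
Proof.
have genE w : NI_gen k adj w = 'X_[set_mnm (closed_nbhd adj w)].
  by rewrite mpolyX_set_mnm.
split=> [[c ->]|/supportedP hf].
  apply: supported_sum => w _; rewrite genE supportedMX; apply/supportedP => m _.
  by apply/existsP; exists w; rewrite mnm_suppD subsetUr.
rewrite [f]mpolyE big_seq; apply: (big_ind (NI adj)).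
- by exists (fun=> 0); rewrite big1 // => w _; rewrite mul0r.
- move=> p q [c ->] [c' ->]; exists (fun w => c w + c' w).
  by rewrite -big_split; apply: eq_bigr => w _; rewrite mulrDl.
move=> m /hf/existsP[w]; rewrite -set_mnm_le => le_w.
exists (fun w' => if w' == w then f@_m *: 'X_[(m - set_mnm (closed_nbhd adj w))%MM] else 0).
rewrite (bigD1 w) //= eqxx big1 => [|w' /negPf ->]; last by rewrite mul0r.
by rewrite addr0 genE -scalerAl -mpolyXD submK.
Qed.

End Squarefree.

(** * Lists indexed by initial segments *)

Lemma all_mkseq (T : Type) (a : pred T) (f : nat -> T) l :
  (forall j, (j < l)%N -> a (f j)) -> all a (mkseq f l).
Proof.
move=> h; rewrite all_map; apply/allP => j; rewrite mem_iota add0n => /h //.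
Qed.

Lemma pairwise_mkseq (T : Type) (r : rel T) (f : nat -> T) l :
  (forall i j, (i < j < l)%N -> r (f i) (f j)) -> pairwise r (mkseq f l).
Proof.
move=> h; rewrite /mkseq pairwise_map.
have : pairwise ltn (iota 0 l) by rewrite -(sorted_pairwise ltn_trans) iota_ltn_sorted.
apply: sub_in_pairwise (allss _) => i j _; rewrite mem_iota => /andP[_ jl] ij.
by apply: h; apply/andP.
Qed.

Lemma has_mkseq_eq (T T' : Type) (a : pred T) (a' : pred T') (f : nat -> T) (f' : nat -> T') l :
  (forall j, (j < l)%N -> a (f j) = a' (f' j)) -> has a (mkseq f l) = has a' (mkseq f' l).
Proof.
move=> h; rewrite !has_map; apply: eq_in_has => j; rewrite mem_iota add0n => /h //.
Qed.

(** * Vertices, closed neighborhoods and pages of the book graph *)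

Section Book.
Variables (k : fieldType) (m : nat).
Local Notation n := (m.+1 + m.+1)%N.
Local Notation nbhd := (closed_nbhd (@book_adj m)).
Implicit Types (S : {set 'I_n}) (w : 'I_n) (j l : nat).

(** Natural-number indices leave index arithmetic to [lia]; they are meant for [j <= m], where
    [inord] is faithful. *)
Definition book_x j : 'I_n := lshift m.+1 (inord j).
Definition book_y j : 'I_n := rshift m.+1 (inord j).
(** Numbering starts at 0: [page j] is the support of e_(j+1), the spine x_0 y_0 being left out. *)
Definition page j : {set 'I_n} := [set book_x j.+1; book_y j.+1].

Lemma eq_x j l : (j <= m)%N -> (l <= m)%N -> (book_x j == book_x l) = (j == l).
Proof. by move=> hj hl; rewrite eq_lshift -val_eqE /= !inordK. Qed.

Lemma eq_y j l : (j <= m)%N -> (l <= m)%N -> (book_y j == book_y l) = (j == l).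
Proof. by move=> hj hl; rewrite eq_rshift -val_eqE /= !inordK. Qed.

Lemma eq_x_y j l : (book_x j == book_y l) = false.
Proof. exact: eq_lrshift. Qed.

Lemma eq_y_x j l : (book_y j == book_x l) = false.
Proof. exact: eq_rlshift. Qed.

Lemma book_vertexP w :
  (exists2 j, (j <= m)%N & w = book_x j) \/ (exists2 j, (j <= m)%N & w = book_y j).
Proof.
case: (split_ordP w) => i ->; [left|right]; exists (val i);
  by [rewrite -ltnS ltn_ord | rewrite /book_x /book_y inord_val].
Qed.

Lemma adj_x_x j l : (j <= m)%N -> (l <= m)%N ->
  book_adj (book_x j) (book_x l) = ((j == 0) && (l != 0) || (l == 0) && (j != 0))%N.
Proof. by move=> hj hl; rewrite /book_adj !(unsplitK (inl _)) /= !inordK. Qed.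

Lemma adj_y_y j l : (j <= m)%N -> (l <= m)%N ->
  book_adj (book_y j) (book_y l) = ((j == 0) && (l != 0) || (l == 0) && (j != 0))%N.
Proof. by move=> hj hl; rewrite /book_adj !(unsplitK (inr _)) /= !inordK. Qed.

Lemma adj_x_y j l : (j <= m)%N -> (l <= m)%N ->
  book_adj (book_x j) (book_y l) = (j == l).
Proof.
by move=> hj hl; rewrite /book_adj (unsplitK (inl _)) (unsplitK (inr _)) /= !inordK.
Qed.

Lemma adj_y_x j l : (j <= m)%N -> (l <= m)%N ->
  book_adj (book_y j) (book_x l) = (j == l).
Proof.
by move=> hj hl; rewrite /book_adj (unsplitK (inl _)) (unsplitK (inr _)) /= !inordK.
Qed.

Definition adjE := (adj_x_x, adj_y_y, adj_x_y, adj_y_x).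
Definition vtxE := (eq_x, eq_y, eq_x_y, eq_y_x).

Lemma nbhd_xS j : (j < m)%N -> nbhd (book_x j.+1) = book_x 0 |: page j.
Proof.
move=> hj; apply/setP => w; rewrite !inE.
case: (book_vertexP w) => -[l hl ->]; rewrite ?(adjE, vtxE) //=; lia.
Qed.

Lemma nbhd_yS j : (j < m)%N -> nbhd (book_y j.+1) = book_y 0 |: page j.
Proof.
move=> hj; apply/setP => w; rewrite !inE.
case: (book_vertexP w) => -[l hl ->]; rewrite ?(adjE, vtxE) //=; lia.
Qed.

Lemma mem_nbhd_x0_x j : (j <= m)%N -> book_x j \in nbhd (book_x 0).
Proof. by move=> hj; rewrite inE ?(adjE, vtxE) //=; lia. Qed.

Lemma mem_nbhd_x0_y j : (j <= m)%N -> (book_y j \in nbhd (book_x 0)) = (j == 0%N).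
Proof. by move=> hj; rewrite inE ?(adjE, vtxE) //=; lia. Qed.

Lemma mem_nbhd_y0_y j : (j <= m)%N -> book_y j \in nbhd (book_y 0).
Proof. by move=> hj; rewrite inE ?(adjE, vtxE) //=; lia. Qed.

Lemma mem_nbhd_y0_x j : (j <= m)%N -> (book_x j \in nbhd (book_y 0)) = (j == 0%N).
Proof. by move=> hj; rewrite inE ?(adjE, vtxE) //=; lia. Qed.

Lemma card_nbhd_x0 : #|nbhd (book_x 0)| = m.+2.
Proof.
have -> : nbhd (book_x 0) = book_y 0 |: [set lshift m.+1 i | i : 'I_m.+1].
  apply/setP => w; case: (book_vertexP w) => -[l hl ->].
    by rewrite mem_nbhd_x0_x // !inE imset_f ?orbT.
  rewrite mem_nbhd_x0_y // !inE vtxE //.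
  rewrite (negPf (_ : book_y l \notin _)) ?orbF //.
  by apply/imsetP => -[i _ /eqP]; rewrite eq_rlshift.
rewrite cardsU1 card_imset ?cardT ?size_enum_ord; last exact: lshift_inj.
rewrite (_ : book_y 0 \notin _) //.
by apply/imsetP => -[i _ /eqP]; rewrite eq_rlshift.
Qed.

Lemma card_nbhd_y0 : #|nbhd (book_y 0)| = m.+2.
Proof.
have -> : nbhd (book_y 0) = book_x 0 |: [set rshift m.+1 i | i : 'I_m.+1].
  apply/setP => w; case: (book_vertexP w) => -[l hl ->]; last first.
    by rewrite mem_nbhd_y0_y // !inE imset_f ?orbT.
  rewrite mem_nbhd_y0_x // !inE vtxE //.
  rewrite (negPf (_ : book_x l \notin _)) ?orbF //.
  by apply/imsetP => -[i _ /eqP]; rewrite eq_lrshift.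
rewrite cardsU1 card_imset ?cardT ?size_enum_ord; last exact: rshift_inj.
rewrite (_ : book_x 0 \notin _) //.
by apply/imsetP => -[i _ /eqP]; rewrite eq_lrshift.
Qed.

Lemma card_page j : #|page j| = 2%N.
Proof. by rewrite cards2 eq_x_y. Qed.

Lemma disjoint_page j l : (j < m)%N -> (l < m)%N -> j != l -> [disjoint page j & page l].
Proof.
move=> hj hl ne; rewrite -setI_eq0; apply/eqP/setP => w; rewrite !inE.
case: (book_vertexP w) => -[i hi ->]; rewrite ?vtxE //; lia.
Qed.

Lemma book_x0_page j : (j < m)%N -> book_x 0 \notin page j.
Proof. by move=> hj; rewrite !inE !vtxE. Qed.

Lemma book_y0_page j : (j < m)%N -> book_y 0 \notin page j.
Proof. by move=> hj; rewrite !inE !vtxE. Qed.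

Lemma page_subset j S : (page j \subset S) = (book_x j.+1 \in S) && (book_y j.+1 \in S).
Proof. by rewrite subUset !sub1set. Qed.

(** * Resolutions of the intermediate ideals *)

Definition pages l := mkseq page l.

Lemma pages_res l : (l <= m)%N ->
  sqfree_res k (contains_some (pages l)) (fun i x => (i <= l)%N /\ x = (2 * i)%N).
Proof.
move=> hl; rewrite -{2}[l](size_mkseq page); apply: koszul_res => //.
  by apply: all_mkseq => j _; rewrite card_page.
by apply: pairwise_mkseq => i j hij; apply: disjoint_page; lia.
Qed.

(** x_0 is coprime to every e_j, so the Koszul complex is coned with itself; the second alternative
    is the copy shifted by one step and one degree. *)
Lemma pages_x0_res l : (l < m)%N ->
  sqfree_res k (fun S => contains_some (pages l) S || ([set book_x 0] \subset S))
    (fun i x => (i <= l /\ x = 2 * i) \/ (i <= l.+1 /\ x.+1 = 2 * i))%N.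
Proof.
move=> hl; have hK := pages_res (ltnW hl).
apply: (sqfree_cone hK hK); rewrite ?cards1.
- move=> S; rewrite contains_someU_disjoint //; apply: all_mkseq => j hj.
  by rewrite disjoint_sym disjoints1 book_x0_page; lia.
- by move=> i x y [_ ->] [_ ->]; lia.
- by move=> i x; left.
- by move=> i x [? ->]; right; lia.
Qed.

(** The product of ideals (u, v)(e_1, ..., e_l). *)
Definition spine_pages l S :=
  ((book_x 0 \in S) || (book_y 0 \in S)) && contains_some (pages l) S.

(** In homological degree [l.+1] only the sharper bound [2 * i] is allowed; for [l = m] this is what
    keeps degrees within [i + m.+1]. *)
Definition spine_deg l i x :=
  ((i <= l) && (x <= (2 * i).+1) || (i <= l.+1) && (x <= 2 * i))%N.

Lemma spine_pages_res l : (l <= m)%N -> sqfree_res k (spine_pages l) (spine_deg l).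
Proof.
elim: l => [_|l IH hl].
  apply: eq_has_min_res (has_min_res0 k _ (Q := spine_deg 0) _) => // mu.
  by rewrite /spine_pages andbF.
have {}IH := IH (ltnW hl).
have disj (v0 : 'I_n) : (forall j, (j < m)%N -> v0 \notin page j) ->
    all (fun A : {set 'I_n} => [disjoint A & v0 |: page l]) (pages l).
  move=> h; apply: all_mkseq => j hj; rewrite disjoint_sym disjoints_subset.
  by rewrite subUset sub1set in_setC -disjoints_subset h ?disjoint_page; lia.
have cx : #|book_x 0 |: page l| = 3%N by rewrite cardsU1 book_x0_page ?card_page.
have cy : #|book_y 0 |: page l| = 3%N by rewrite cardsU1 book_y0_page ?card_page.
(* Adding u e_(l+1): the colon ideal is (e_1, ..., e_l). *)
have H1 : sqfree_res k (fun S => spine_pages l S || (book_x 0 |: page l \subset S))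
    (spine_deg l.+1).
  apply: sqfree_cone IH (pages_res (ltnW hl)) _ _ _ _; rewrite ?cx.
  - move=> S; rewrite /spine_pages contains_someU_disjoint; last exact/disj/book_x0_page.
    by rewrite !inE eqxx !orbT.
  - by move=> i x y hx [_ ->]; move: hx; rewrite /spine_deg; lia.
  - by move=> i x; rewrite /spine_deg; lia.
  - by move=> i x [? ->]; rewrite /spine_deg; lia.
(* Adding v e_(l+1): the colon ideal is (e_1, ..., e_l, u), where u comes from u e_(l+1). *)
have {}H1 : sqfree_res k (fun S => (spine_pages l S || (book_x 0 |: page l \subset S))
    || (book_y 0 |: page l \subset S)) (spine_deg l.+1).
  have H1' : sqfree_res k (fun S => spine_pages l S || (book_x 0 |: page l \subset S))
      (fun i x => (x <= (2 * i).+1)%N /\ spine_deg l.+1 i x).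
    by apply: eq_has_min_res H1 => // i x h; split=> //; move: h; rewrite /spine_deg; lia.
  apply: sqfree_cone H1' (pages_x0_res hl) _ _ _ _; rewrite ?cy.
  - move=> S; rewrite /spine_pages contains_someU_disjoint; last exact/disj/book_y0_page.
    rewrite !inE eqxx !orbT /= subUset sub1set.
    rewrite (_ : page l \subset _) ?andbT; last by rewrite subsetU // subsetUr orbT.
    by rewrite !inE !vtxE //= !orbF sub1set.
  - by move=> i x y [hx _] h; lia.
  - by move=> i x [].
  - by move=> i x h; rewrite /spine_deg; lia.
apply: eq_has_min_res H1 => // mu; rewrite /spine_pages /pages mkseqS /contains_some has_rcons.
rewrite !subUset !sub1set.
by case: (book_x 0 \in _); case: (book_y 0 \in _); case: (book_x _ \in _);
  case: (book_y _ \in _); rewrite ?orbT ?orbF.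
Qed.

Lemma singles_res (z : nat -> 'I_n) :
  (forall i j, (i < j < m)%N -> z i != z j) ->
  sqfree_res k (contains_some (mkseq (fun j => [set z j]) m)) (fun i x => (i <= m)%N /\ x = i).
Proof.
move=> hz.
have := @koszul_res k n (mkseq (fun j => [set z j]) m) 1 isT.
rewrite size_mkseq => H; apply: eq_has_min_res (H _ _) => //.
- by move=> i x; rewrite mul1n.
- by apply: all_mkseq => j _; rewrite cards1.
- by apply: pairwise_mkseq => i j hij; rewrite disjoints1 inE hz.
Qed.

(** N[x_0] contains u, v and all x_j, so modulo it each page reduces to y_j and the colon ideal is
    (y_1, ..., y_m). Its degree i becomes i + m + 2 in homological degree i + 1, exactly on the
    bound. *)
Lemma book_res_x0 :
  sqfree_res k (fun S => spine_pages m S || (nbhd (book_x 0) \subset S))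
    (fun i x => x <= i + m.+1)%N.
Proof.
apply: sqfree_cone (spine_pages_res (leqnn m)) (@singles_res (fun j => book_y j.+1) _) _ _ _ _;
  rewrite ?card_nbhd_x0.
- by move=> i j hij; rewrite vtxE; lia.
- move=> S; rewrite /spine_pages !inE eqxx !orbT /=.
  apply: has_mkseq_eq => j hj; rewrite page_subset sub1set.
  by rewrite !in_setU mem_nbhd_x0_x // mem_nbhd_x0_y //= orbT orbF.
- by move=> i x y hx [hi ->]; move: hx; rewrite /spine_deg; lia.
- by move=> i x; rewrite /spine_deg; lia.
- by move=> i x [_ ->]; lia.
Qed.

(** * The closed neighborhood ideal of the book graph and its regularity *)

Lemma book_nbhd_subset S :
  [exists w, nbhd w \subset S] =
  (spine_pages m S || (nbhd (book_x 0) \subset S)) || (nbhd (book_y 0) \subset S).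
Proof.
apply/existsP/idP => [[w]|].
  case: (book_vertexP w) => -[[|j] hj ->].
  - by move=> ->; rewrite orbT.
  - rewrite nbhd_xS // subUset sub1set /spine_pages => /andP[-> hp] /=.
    by apply/orP; left; apply/orP; left; apply/hasP; exists (page j) => //;
      apply: map_f; rewrite mem_iota.
  - by move=> ->; rewrite orbT.
  - rewrite nbhd_yS // subUset sub1set /spine_pages => /andP[-> hp]; rewrite orbT /=.
    by apply/orP; left; apply/orP; left; apply/hasP; exists (page j) => //;
      apply: map_f; rewrite mem_iota.
case/orP => [/orP[|]|]; [|by exists (book_x 0)|by exists (book_y 0)].
case/andP => h /hasP[A /mapP[j]]; rewrite mem_iota => /andP[_ hj] {A}-> hp.
case/orP: h => h; [exists (book_x j.+1)|exists (book_y j.+1)];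
  by rewrite ?nbhd_xS ?nbhd_yS // subUset sub1set h.
Qed.

Lemma book_regularity : (0 < m)%N -> regularity_is (@NI k _ (@book_adj m)) m.+1.
Proof.
move=> m_gt0; have hG : sqfree_res k (contains_some (mkseq (fun j => [set book_x j.+1]) m))
    (fun i x => (i <= m)%N /\ x = i).
  by apply: singles_res => i j hij; rewrite vtxE; lia.
have [||||b [d [a [res hQ [j1 ej1]]]]] := cone_min_res
  (f := set_mnm (nbhd (book_y 0))) (Q'' := fun i x => x <= i + m.+1)%N book_res_x0 hG.
- move=> mu; rewrite mnm_suppD; set S := mnm_supp mu.
  rewrite /spine_pages !(in_setU, inE) eqxx !orbT /=.
  have -> : contains_some (pages m) (S :|: nbhd (book_y 0)) =
            contains_some (mkseq (fun j => [set book_x j.+1]) m) S.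
    apply: has_mkseq_eq => j hj; rewrite page_subset sub1set.
    by rewrite !in_setU mem_nbhd_y0_y // mem_nbhd_y0_x //= orbT orbF andbT.
  (* In the colon ideal u v x_1 ... x_m becomes a multiple of x_1, which exists as m is positive, so
     (x_1, ..., x_m) absorbs it. *)
  case: (boolP (nbhd (book_x 0) \subset _)) => [/subsetP/(_ (book_x 1))|]; last by rewrite orbF.
  rewrite orbT mem_nbhd_x0_x // in_setU mem_nbhd_y0_x // orbF => /(_ isT) h.
  by apply/hasP; exists [set book_x 1]; rewrite ?sub1set //;
    apply: (map_f (fun j => [set book_x j.+1]) (x := 0%N)); rewrite mem_iota.
- by move=> i x y hx [_ ->]; rewrite mdeg_set_mnm card_nbhd_y0; lia.
- by [].
- by move=> i x [_ ->]; rewrite mdeg_set_mnm card_nbhd_y0; lia.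
have {}res : is_min_graded_free_res (@NI k _ (@book_adj m)) d a.
  apply: min_res_ext res => p; rewrite NI_mon_ideal /mon_ideal /supported.
  rewrite (_ : all _ _ = all (fun mu => [exists w, nbhd w \subset mnm_supp mu]) (msupp p)) //.
  by apply: eq_all => mu; rewrite book_nbhd_subset set_mnm_le.
split; first by exists b, d, a.
(* An arbitrary minimal resolution is compared with the cone in both directions. *)
move=> b' d' a' res'; split=> [i j|].
  by have [j' <-] := min_res_degrees res' res j; apply: hQ.
have [j ej] := min_res_degrees res res' j1.
(* The generator u v y_1 ... y_m has degree m + 2 = 1 + (m + 1) in homological degree 1. *)
by exists 1%N, j; rewrite ej ej1 mdeg_set_mnm card_nbhd_y0.
Qed.

End Book.

(** * The matching number *)

(** Disjoint edges use two vertices each out of 2(m + 1), and the edges x_i y_i form a perfect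
    matching. *)
Lemma book_matching_number m : matching_number (@book_adj m) = m.+1.
Proof.
apply/eqP; rewrite eqn_leq; apply/andP; split.
  apply/bigmax_leqP => M /andP[/forall_inP edges /forall_inP disj].
  have cardM e : e \in M -> #|e| = 2%N.
    case/edges/existsP => u /existsP[v /andP[uv /eqP ->]]; rewrite cards2.
    suff -> : u != v by [].
    apply: contraTneq uv => ->; rewrite /book_adj.
    by case: (split v) => i; case: (_ == _).
  have tI : trivIset M.
    by apply/trivIsetP => e f eM fM; have /forall_inP/(_ f fM)/implyP := disj e eM.
  have := max_card (mem (cover M)); rewrite card_ord.
  have /eqP <- := tI.
  rewrite (eq_bigr (fun=> 2%N)) // sum_nat_const; lia.
pose M := [set [set lshift m.+1 i; rshift m.+1 i] | i : 'I_m.+1].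
have mem_edge (i : 'I_m.+1) : lshift m.+1 i \in [set lshift m.+1 i; rshift m.+1 i].
  by rewrite !inE eqxx.
have cM : #|M| = m.+1.
  rewrite card_imset ?card_ord // => i j e; have := mem_edge i.
  by rewrite e !inE eq_lrshift orbF eq_lshift => /eqP.
rewrite -{1}cM; apply: leq_bigmax_cond; apply/andP; split.
  apply/forall_inP => _ /imsetP[i _ ->]; apply/existsP; exists (lshift m.+1 i).
  apply/existsP; exists (rshift m.+1 i).
  by rewrite /book_adj (unsplitK (inl i)) (unsplitK (inr i)) !eqxx.
apply/forall_inP => _ /imsetP[i _ ->]; apply/forall_inP => _ /imsetP[j _ ->].
apply/implyP => ne; have {ne} ij : i != j by apply: contraNneq ne => ->.
rewrite -setI_eq0; apply/eqP/setP => w; rewrite !inE.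
case: (split_ordP w) => l ->; rewrite ?eq_lshift ?eq_rshift ?eq_lrshift ?eq_rlshift ?orbF /=;
  by apply/negP => /andP[/eqP -> /eqP e]; rewrite e eqxx in ij.
Qed.

Theorem theorem2p9 (k : fieldType) (m : nat) (hm : (0 < m)%N) :
  regularity_is (@NI k _ (@book_adj m)) m.+1 /\ matching_number (@book_adj m) = m.+1.
Proof. by split; [apply: book_regularity | apply: book_matching_number]. Qed.
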